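(* Let $S$ be any finite (possibly empty) set of primes. Then: (a) there exist $n\ge 1$ and a finite nonempty set $I\subset\mathbb{N}^n$ such that for every algebraically closed field $K$, $Z_I(K)=\emptyset$ if and only if $\operatorname{char}K\in S$; (b) there exist $n\ge 1$ and a finite nonempty set $I\subset\mathbb{N}^n$ such that for every algebraically closed field $K$, $Z_I(K)=\emptyset$ if and only if $\operatorname{char}K\notin S$.
   Context: $\mathbb{N}$ denotes the set of all non-negative integers (including $0$). For $i=(i_1,\dots,i_n)\in\mathbb{N}^n$, $X^i=X_1^{i_1}\cdots X_n^{i_n}$. For a field $K$, the support of $P\in K[X]=K[X_1,\dots,X_n]$ is the finite set $I(P)\subset\mathbb{N}^n$ such that $P=\sum_{i\in I(P)}a_iX^i$ with all $a_i\in K\setminus\{0\}$. A polynomial is reducible (decomposable) if it is a product of two nonconstant polynomials in $K[X]$; in particular nonzero constants are not reducible. For finite nonempty $I\subset\mathbb{N}^n$, $Z_I(K)=\{P\in K[X]\mid I(P)=I,\ P\text{ is reducible}\}$. *)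

(* Defs.v *)
From mathcomp Require Export all_boot all_order all_algebra.
From mathcomp Require Export finmap mpoly.

Set Implicit Arguments.
Unset Strict Implicit.
Unset Printing Implicit Defensive.

Import GRing.Theory.
Local Open Scope ring_scope.

(* As [msize p] is 1 + deg p (and 0 for p = 0), [1 < msize p] says that p is
   nonconstant. *)
Definition reducible (n : nat) (K : fieldType) (P : {mpoly K[n]}) : Prop :=
  exists Q R : {mpoly K[n]}, [/\ (1 < msize Q)%N, (1 < msize R)%N & P = Q * R].

Definition Z_ (n : nat) (I : {fset 'X_{1..n}}) (K : fieldType)
    (P : {mpoly K[n]}) : Prop :=
  msupp P =i I /\ reducible P.

Definition Z_empty (n : nat) (I : {fset 'X_{1..n}}) (K : fieldType) : Prop :=
  forall P : {mpoly K[n]}, ~ Z_ I P.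

(* [pchar K] is the set of primes p with p%:R = 0 in K: it is the singleton of
   the characteristic when this is positive, and is empty in characteristic 0.
   Hence for a set S of primes (so that 0 is not in S) this says char K \in S. *)
Definition char_in (K : fieldType) (S : {fset nat}) : Prop :=
  exists2 p : nat, p \in S & p \in [pchar K].

(* Main.v *)
(* In variables y, x, z consider P = q + z f, where q = a + c y + b x is a linear
   form and f is supported on 1, y^m, x^2 y^j (j <= m), x^3 y^j (j < m) and
   optionally on x, with m the product of S. If P is reducible then q divides f,
   so f vanishes on the line x = -(a + c y)/b; the y-derivative of f there, taken
   at the point x = 0, is a relation between the terms y^m and x alone, and it
   says that x occurs in f if and only if m <> 0 in K. Conversely
   (1 + x - y)(g0 + x g1 + x^2 u) = 1 - y^m + m x + x^2 (g1 + (1 - y) u) + x^3 u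
   for suitable polynomials g0 and g1 in y, and u can be chosen so that u and
   g1 + (1 - y) u have no vanishing coefficient, in every characteristic. So the
   support with x gives (a) and the one without x gives (b). *)
From HB Require Import structures.
Require Import Defs.
From mathcomp Require Import zify ring.

Set Implicit Arguments.
Unset Strict Implicit.
Unset Printing Implicit Defensive.

Import GRing.Theory.
Local Open Scope ring_scope.

(** * Trivariate polynomials as iterated univariate ones *)

Section Poly3.

Variable K : fieldType.

Definition mnm3 (j i k : nat) : 'X_{1..3} := [multinom nth 0%N [:: j; i; k] l | l < 3].

Lemma mnm3_eta (mm : 'X_{1..3}) :
  mm = mnm3 (mm 0) (mm 1) (mm (2 : 'I_3)).
Proof.
apply/mnmP; case=> [[|[|[|i]]]] // Hi; rewrite mnmE /=;
  by congr (mm _); apply: val_inj.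
Qed.

(* The variables 'X_0, 'X_1, 'X_2 are y, x, z, with y innermost. *)
Definition vars3 (i : 'I_3) : {poly {poly {poly K}}} :=
  tnth [tuple 'X%:P%:P; 'X%:P; 'X] i.

(** In this form sizes, roots and derivatives can be taken in one variable at a time; coefficients
    are read off in the order z, x, y. *)
Definition uni3 : {mpoly K[3]} -> {poly {poly {poly K}}} :=
  mmap (polyC \o polyC \o polyC) vars3.

HB.instance Definition _ :=
  GRing.isAdditive.Build _ _ uni3 (@mmap_is_additive _ _ _ _ _).
HB.instance Definition _ :=
  GRing.isMultiplicative.Build _ _ uni3 (@mmap_is_multiplicative _ _ _ _ _).

Lemma uni3D : {morph uni3 : p q / p + q}. Proof. exact: rmorphD. Qed.
Lemma uni3B : {morph uni3 : p q / p - q}. Proof. exact: rmorphB. Qed.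
Lemma uni3M : {morph uni3 : p q / p * q}. Proof. exact: rmorphM. Qed.
Lemma uni31 : uni3 1 = 1. Proof. exact: rmorph1. Qed.

Lemma uni3C c : uni3 c%:MP = c%:P%:P%:P.
Proof. by rewrite /uni3 mmapC. Qed.

Lemma uni3X i : uni3 'X_i = vars3 i.
Proof. by rewrite /uni3 mmapX mmap1U. Qed.

Lemma uni3_coef p j i k : (uni3 p)`_k`_i`_j = p@_(mnm3 j i k).
Proof.
rewrite {2}[p]mpolyE /uni3 /mmap !coef_sum raddf_sum.
apply: eq_bigr => mm _ /=; rewrite mcoeffZ mcoeffX coefCM coefCM coefCM.
congr (_ * _); rewrite /mmap1 !big_ord_recl big_ord0 mulr1.
rewrite /vars3 !(tnth_nth 0) /= -!rmorphXn /=.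
rewrite !coefCM coefXn mulr_natr coefMn coefXn.
rewrite [in RHS](mnm3_eta mm).
have -> : lift ord0 (lift ord0 (ord0 : 'I_1)) = 2 :> 'I_3 by apply: val_inj.
have -> : lift ord0 (ord0 : 'I_2) = 1 :> 'I_3 by apply: val_inj.
have -> : (mnm3 (mm 0) (mm 1) (mm (2 : 'I_3)) == mnm3 j i k) =
  [&& j == mm 0, i == mm 1 & k == mm (2 : 'I_3)].
  apply/eqP/and3P => [/mnmP E|[/eqP-> /eqP-> /eqP->]] //.
  split; apply/eqP.
  - by have := E 0; rewrite !mnmE /=.
  - by have := E 1; rewrite !mnmE /=.
  - by have := E (2 : 'I_3); rewrite !mnmE /=.
by rewrite -mulrnA -mulnb -mulnb mulr_natr coefMn coefXn -mulrnA.
Qed.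


Lemma uni3_msize p j i k :
  (0 < j + i + k)%N -> (uni3 p)`_k`_i`_j != 0 -> (1 < msize p)%N.
Proof.
move=> jik; rewrite uni3_coef -mcoeff_msupp => /msize_mdeg_lt; apply: leq_ltn_trans.
by rewrite mdegE !big_ord_recl big_ord0 !mnmE /= addn0 addnA.
Qed.

Lemma uni3_const p c : uni3 p = c%:P%:P%:P -> (msize p <= 1)%N.
Proof.
move=> pc; suff -> : p = c%:MP by rewrite msizeC leq_b1.
apply/mpolyP => mm; rewrite (mnm3_eta mm) -!uni3_coef pc.
by rewrite uni3C.
Qed.

Lemma uni3_horner_alg (p : {poly K}) : uni3 (horner_alg 'X_0 p) = p%:P%:P.
Proof.
elim/poly_ind: p => [|p c IHp]; first by rewrite !rmorph0.
rewrite rmorphD rmorphM /= horner_algX horner_algC !rmorphD !rmorphM /= IHp.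
by rewrite uni3X -mul_mpolyC mulr1 uni3C.
Qed.

(** * Factors of polynomials of degree one in the outermost variable *)

(** The degrees of [a] and [b] in x add up to 1. If [a] has degree 0, it divides the leading
    coefficient [c], a nonzero constant, so it is itself constant. Otherwise [b] is free of x and
    nonzero, and the root of the product is a root of [a]. *)
Lemma dvd_linear (c : K) (q : {poly K}) (a b : {poly {poly K}}) :
  c != 0 -> c%:P *: 'X + q%:P = a * b ->
  (exists d, a = d%:P%:P) \/ a.[- (c^-1 *: q)] = 0.
Proof.
move=> c0 E.
have cP0 : c%:P != 0 :> {poly K} by rewrite polyC_eq0.
have sE : size (a * b) = 2%N.
  by rewrite -E size_polyDl size_scale ?size_polyX ?size_polyC //; case: eqP.
have ab0 : a * b != 0 by rewrite -size_poly_eq0 sE.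
have [a0 b0] : a != 0 /\ b != 0.
  by move: ab0; rewrite mulf_eq0 negb_or => /andP.
have root0 : (a * b).[- (c^-1 *: q)] = 0.
  rewrite -E !hornerE /= mulrN -scalerAr mul_polyC scalerA mulVf // scale1r.
  by rewrite addNr.
have lead : lead_coef a * lead_coef b = c%:P.
  rewrite -lead_coefM -E lead_coefDl ?lead_coefZ ?lead_coefX ?mulr1 //.
  by rewrite size_scale ?size_polyX ?size_polyC //; case: eqP.
have unit_lead (d e : {poly K}) : d * e = c%:P -> exists d0, d = d0%:P.
  move=> de; have := congr1 (fun p : {poly K} => size p) de.
  have : d * e != 0 by rewrite de.
  rewrite mulf_eq0 negb_or => /andP[d0 e0].
  rewrite size_mul // size_polyC c0 /= => sde.
  exists d`_0; apply: size1_polyC.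
  move: sde d0 e0; rewrite -!size_poly_gt0.
  by case: (size d) (size e) => [|[|n]] [|[|k]] //=; rewrite addnS.
move: sE; rewrite size_mul // => sE.
have [sa|sa] := leqP (size a) 1.
  left; have [d ad] := unit_lead _ _ lead.
  exists d; rewrite [a]size1_polyC //; congr (_%:P).
  rewrite -ad /lead_coef; congr (a`_ _).
  by move: sa; case: (size a) => [|[|]].
right; have sb : (size b <= 1)%N.
  by move: sE sa; case: (size a) => [|[|k]] //= [<-] _; rewrite leq_addl.
move/eqP: root0; rewrite hornerM mulf_eq0 => /orP[/eqP //|].
rewrite [b]size1_polyC // hornerC => /eqP b00.
by move: b0; rewrite [b]size1_polyC // b00 eqxx.
Qed.

(* Comparing degrees in the outermost variable, one of the two factors divides
   both the linear polynomial and [f]. *)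
Lemma factor_linear (c : K) (q : {poly K}) (f : {poly {poly K}})
    (A B : {poly {poly {poly K}}}) :
  c != 0 -> f != 0 -> A * B = f *: 'X + (c%:P *: 'X + q%:P)%:P ->
  [\/ exists d, A = d%:P%:P%:P, exists d, B = d%:P%:P%:P
    | f.[- (c^-1 *: q)] = 0].
Proof.
move=> c0 f0; set L := _ + q%:P => E.
have sE : size (A * B) = 2%N.
  by rewrite E size_polyDl size_scale ?size_polyX ?size_polyC //; case: eqP.
have [A0 B0] : A != 0 /\ B != 0.
  have : A * B != 0 by rewrite -size_poly_eq0 sE.
  by rewrite mulf_eq0 negb_or => /andP.
(* A factor [a] free of z divides both z-coefficients of the product, [L] and [f], so a root of [a]
   is a root of [f]. *)
have half (a : {poly {poly K}}) C : a%:P * C = A * B ->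
    (exists d, a = d%:P%:P) \/ f.[- (c^-1 *: q)] = 0.
  move=> aC.
  have La : L = a * C`_0.
    by rewrite -coefCM aC E coefD coefZ coefX coefC mulr0 add0r.
  have fa : f = a * C`_1.
    by rewrite -coefCM aC E coefD coefZ coefX coefC mulr1 addr0.
  have [|a0] := dvd_linear c0 La; first by left.
  by right; rewrite fa hornerM a0 mul0r.
move: sE; rewrite size_mul // => sE.
have [sA|sA] := leqP (size A) 1.
  have [||?] := half A`_0 B; rewrite -?size1_polyC //.
    by move=> [d ad]; apply: Or31; exists d; rewrite [A]size1_polyC // ad.
  exact: Or33.
have sB : (size B <= 1)%N.
  by move: sE sA; case: (size A) => [|[|k]] //= [<-] _; rewrite leq_addl.
have [||?] := half B`_0 A; rewrite -?size1_polyC 1?mulrC //.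
  by move=> [d bd]; apply: Or32; exists d; rewrite [B]size1_polyC // bd.
exact: Or33.
Qed.

(* Differentiating [f.[r] = 0] at the root of [r] only sees the terms of degree
   at most 1 of [f]. *)
Lemma deriv_at_root (f : {poly {poly K}}) (r : {poly K}) (y : K) :
  f.[r] = 0 -> root r y ->
  (f`_0)^`().[y] + (f`_1).[y] * r^`().[y] = 0.
Proof.
move=> fr /rootP ry.
have fE : f = (f`_0)%:P + (f`_1)%:P * 'X + drop_poly 2 f * 'X^2.
  rewrite -{1}[f](poly_take_drop 2); congr (_ + _).
  by apply/polyP => -[|[|i]]; rewrite coef_take_poly coefD coefC coefCM coefX
    /= ?mulr0 ?addr0 ?mulr1 ?add0r.
(* In this nested form, the derivative of the second summand at a zero of [r] is
   [r^]()[times]f[_1]. *)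
have E : f`_0 + r * (f`_1 + r * (drop_poly 2 f).[r]) = 0.
  have := congr1 (fun g => g.[r]) fE.
  rewrite fr !hornerD 2!hornerM !hornerC hornerX hornerXn => fr0; rewrite [RHS]fr0; ring.
have := congr1 (fun p => p^`().[y]) E.
rewrite derivD derivM deriv0 !hornerE ry /= => <-.
ring.
Qed.

End Poly3.

(** * The support, and what reducibility forces on its flag *)

(* Exponents [j], [i], [k] of y, x, z; the flag [b] tells whether x z occurs. *)
Definition in_support (m : nat) (b : bool) (j i k : nat) : bool :=
  match k, i with
  | 0, 0 => j < 2
  | 0, 1 => j == 0
  | 1, 0 => (j == 0) || (j == m)
  | 1, 1 => b && (j == 0)
  | 1, 2 => j < m.+1
  | 1, 3 => j < m
  | _, _ => false
  end%N.

(** The bounded multinomials supply a finite range to filter; the monomials selected have degree at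
    most m + 3, so the bound loses none. *)
Definition test_support (m : nat) (b : bool) : {fset 'X_{1..3}} :=
  [fset mm in [seq bmnm t | t : 'X_{1..3 < m + 5}]
    | in_support m b (mm 0) (mm 1) (mm (2 : 'I_3))]%fset.

Lemma mem_test_support m b j i k :
  (mnm3 j i k \in test_support m b) = in_support m b j i k.
Proof.
rewrite !inE !mnmE /= andbC; apply/andb_idr => jik.
have lt : (mdeg (mnm3 j i k) < m + 5)%N.
  rewrite mdegE !big_ord_recl big_ord0 !mnmE /=.
  case: k i jik => [|[|k]] [|[|[|[|i]]]] //=; lia.
by apply/imageP; exists (BMultinom lt).
Qed.

Lemma msupp_test_support (K : fieldType) m b (p : {mpoly K[3]}) :
  msupp p =i test_support m b <->
  forall j i k, ((uni3 p)`_k`_i`_j != 0) = in_support m b j i k.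
Proof.
split=> [E j i k|E mm]; first by rewrite uni3_coef -mcoeff_msupp E mem_test_support.
by rewrite (mnm3_eta mm) mem_test_support -E uni3_coef mcoeff_msupp.
Qed.

Lemma test_support_reducible (K : fieldType) m b (p : {mpoly K[3]}) :
  (0 < m)%N -> msupp p =i test_support m b -> reducible p -> (m%:R != 0 :> K) = b.
Proof.
move=> m0 /msupp_test_support E [A [B [sA sB pAB]]].
have Z j i k : ~~ in_support m b j i k -> (uni3 p)`_k`_i`_j = 0.
  by rewrite -E negbK => /eqP.
pose q := ((uni3 p)`_0)`_0; pose f := (uni3 p)`_1; pose c := (uni3 p)`_0`_1`_0.
have c0 : c != 0 by rewrite E.
have q0 : q`_0 != 0 by rewrite E.
have q1 : q`_1 != 0 by rewrite E.
have f0 : f != 0.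
  apply/eqP => f0; have := E 0%N 0%N 1%N.
  by rewrite -/f f0 !coef0 eqxx.
have uE : uni3 p = f *: 'X + (c%:P *: 'X + q%:P)%:P.
  apply/polyP => -[|[|k]]; rewrite coefD coefZ coefX coefC /=.
  - rewrite mulr0 add0r; apply/polyP => -[|[|i]]; rewrite coefD coefZ coefX coefC /=.
    + by rewrite mulr0 add0r.
    + rewrite mulr1 addr0; apply/polyP => -[|j]; rewrite coefC //=.
      by apply: Z.
    + by rewrite mulr0 addr0; apply/polyP => j; rewrite coef0; apply: Z.
  - by rewrite mulr1 addr0.
  - rewrite mulr0 addr0; apply/polyP => i; apply/polyP => j; rewrite !coef0.
    by apply: Z.
have qE : q = q`_1 *: 'X + (q`_0)%:P.
  apply/polyP => -[|[|j]]; rewrite coefD coefZ coefX coefC /= ?mulr0 ?mulr1 ?add0r ?addr0 //.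
  by apply: Z.
have [[d Ad]|[d Bd]|fr] : [\/ exists d, uni3 A = d%:P%:P%:P,
    exists d, uni3 B = d%:P%:P%:P | f.[- (c^-1 *: q)] = 0].
- by apply: factor_linear; rewrite // -uE pAB rmorphM.
- by have := uni3_const Ad; rewrite leqNgt sA.
- by have := uni3_const Bd; rewrite leqNgt sB.
(* The zero of [q]: there the line q + c x = 0 meets x = 0. It is nonzero because both coefficients
   of [q] are, so powers of [y] do not vanish. *)
pose y := - (q`_0 / q`_1).
have y0 : y != 0 by rewrite oppr_eq0 mulf_neq0 ?invr_neq0.
have ry : root (- (c^-1 *: q)) y.
  apply/rootP; rewrite hornerN hornerZ qE hornerD hornerZ hornerX hornerC.
  by rewrite /y; field; rewrite c0 q1.
have := deriv_at_root fr ry.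
have -> : f`_0 = (f`_0`_0)%:P + f`_0`_m *: 'X^m.
  apply/polyP => j; rewrite coefD coefC coefZ coefXn.
  have [->|j0] := eqVneq j 0%N; first by rewrite eq_sym (gtn_eqF m0) mulr0 addr0.
  rewrite add0r; have [->|jm] := eqVneq j m; first by rewrite mulr1.
  by rewrite mulr0; apply: Z; rewrite /= negb_or j0.
have -> : f`_1 = (f`_1`_0)%:P.
  apply/polyP => -[|j]; rewrite coefC //=; apply: Z.
  by rewrite /= andbF.
have -> : (- (c^-1 *: q))^`() = (- (c^-1 * q`_1))%:P.
  rewrite qE derivN derivZ derivD derivZ derivX derivC addr0 coefD coefZ coefX coefC.
  by rewrite mulr1 addr0 -mul_polyC -[_ *: 1]mul_polyC mulr1 -polyCM polyCN.
rewrite derivD derivC derivZ derivXn add0r hornerZ hornerMn hornerXn !hornerC.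
have fm : f`_0`_m != 0 by rewrite E /= eqxx orbT.
have -> : f`_0`_m * (y ^+ m.-1 *+ m) = m%:R * (f`_0`_m * y ^+ m.-1).
  by rewrite -mulr_natl; ring.
have w0 : f`_0`_m * y ^+ m.-1 != 0 by rewrite mulf_neq0 // expf_neq0.
have := E 0%N 1%N 1%N; rewrite -/f /= andbT => <- /eqP.
rewrite mulrN subr_eq0 => /eqP mE.
(* [mE] equates m times a nonzero element with [f]_1[_0] times a nonzero element, so m and the
   coefficient of x in [f] vanish together. *)
have v0 : c^-1 * q`_1 != 0 by rewrite mulf_neq0 ?invr_neq0.
have := congr1 (fun z => z == 0) mE.
by rewrite /= mulf_eq0 (negbTE w0) orbF mulf_eq0 (negbTE v0) orbF => ->.
Qed.

(** * Construction of a reducible polynomial with the prescribed support *)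

(** A root of X (X - a) - 1 will do, since X (X - a) vanishes at both 0 and a. *)
Lemma closed_avoid (K : closedFieldType) (a : K) :
  exists x : K, (x != 0) && (x != a).
Proof.
have /closed_rootP[x] : size ('X * ('X - a%:P) - 1 : {poly K}) != 1%N.
  rewrite size_polyDl; first by rewrite mulrC size_mulX ?polyXsubC_eq0 ?size_XsubC.
  by rewrite size_polyN size_poly1 mulrC size_mulX ?polyXsubC_eq0 ?size_XsubC.
rewrite rootE !hornerE subr_eq0 => /eqP xa; exists x.
apply/andP; split; apply/eqP => E; move/eqP: xa; rewrite E ?subrr ?mul0r ?mulr0;
  by rewrite eq_sym oner_eq0.
Qed.

(* The coefficients of [u] are chosen one after the other, each avoiding 0 and
   one further value. *)
Lemma full_coef_poly (K : closedFieldType) (m : nat) (g : {poly K}) :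
  (0 < m)%N -> (size g <= m)%N ->
  exists u : {poly K},
    (forall j, (u`_j != 0) = (j < m)%N) /\
    (forall j, ((g + (1 - 'X) * u)`_j != 0) = (j < m.+1)%N).
Proof.
move=> m0 sg.
pose pick a := xchoose (@closed_avoid K a).
have pick0 a : pick a != 0 by have /andP[] := xchooseP (closed_avoid a).
have pickN a : pick a != a by have /andP[] := xchooseP (closed_avoid a).
(* For 0 < j < m the j-th coefficient of g + (1 - X) u is g_j + u_j - u_(j-1), so u_j has to avoid
   u_(j-1) - g_j. *)
pose t := fix t j := pick (if j is i.+1 then t i - g`_j else - g`_0).
have t0 j : t j != 0 by case: j => [|j]; apply: pick0.
exists (\poly_(j < m) t j); split=> j.
  by rewrite coef_poly; case: ltnP; rewrite ?eqxx ?t0.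
rewrite mulrBl mul1r coefD coefB coefXM !coef_poly.
case: j => [|j] /=.
  rewrite m0 subr0 addrC -[X in _ + X]opprK subr_eq0; exact: pickN.
rewrite ltnS; have [jm|jm] := ltnP j.+1 m.
  rewrite (ltnW jm) addrCA -[X in _ + X]opprB subr_eq0; exact: pickN.
(* From index m on, only the shifted term is left: it is - u_(m-1) at index m, and 0 beyond. *)
rewrite [g`_j.+1]nth_default ?(leq_trans sg) // !add0r.
by rewrite oppr_eq0; case: ltnP; rewrite ?eqxx ?t0.
Qed.

(** With g0 = 1 + ... + X^(m-1), the difference m - g0 vanishes at 1 in every characteristic, and g1
    is its quotient by 1 - X. The two equations give the coefficients of 1 and x in (1 + x - y)(g0 +
    x g1 + x^2 u). *)
Lemma geometric_twice (K : fieldType) (m : nat) : (0 < m)%N ->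
  exists g0 g1 : {poly K}, [/\ (1 - 'X) * g0 = 1 - 'X^m,
     g0 + (1 - 'X) * g1 = m%:R & (size g1 <= m)%N].
Proof.
move=> m0; pose g0 : {poly K} := \sum_(i < m) 'X^i.
have E0 : (1 - 'X) * g0 = 1 - 'X^m.
  by rewrite -[X in _ = X]opprB subrX1 -mulNr opprB.
have /factor_theorem[h hE] : root (m%:R - g0) 1.
  rewrite rootE hornerD hornerN horner_sum -polyC_natr hornerC.
  under eq_bigr do rewrite hornerXn expr1n.
  by rewrite sumr_const card_ord subrr.
exists g0, (- h); split=> //.
  by rewrite mulrN -mulNr opprB mulrC -polyC1 -hE addrC subrK.
rewrite size_polyN; have [->|h0] := eqVneq h 0; first by rewrite size_poly0.
have : (size (m%:R - g0)%R <= m)%N.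
  apply: leq_trans (size_polyD _ _) _; rewrite geq_max size_polyN; apply/andP; split.
    by apply: leq_trans m0; rewrite -polyC_natr size_polyC_leq1.
  by apply: leq_trans (size_sum _ _ _) _; apply/bigmax_leqP => i _; rewrite size_polyXn.
by rewrite hE size_Mmonic ?monicXsubC // size_XsubC addn2 => /ltnW.
Qed.

Lemma test_support_exists (K : closedFieldType) m : (0 < m)%N ->
  exists p : {mpoly K[3]}, msupp p =i test_support m (m%:R != 0 :> K) /\ reducible p.
Proof.
move=> m0.
have [g0 [g1 [E0 E1 sg1]]] := geometric_twice K m0.
have [u [uP]] := full_coef_poly m0 sg1; set v := g1 + _ => vP.
pose e := @horner_alg K {mpoly K[3]} 'X_0.
pose x : {mpoly K[3]} := 'X_1; pose z : {mpoly K[3]} := 'X_(2 : 'I_3).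
pose q := 1 + x - e 'X; pose g := e g0 + x * (e g1 + x * e u).
have uq : uni3 q = ((1 - 'X)%:P + 'X)%:P.
  rewrite /q uni3B uni3D uni31 uni3X uni3_horner_alg /vars3 (tnth_nth 0) /=.
  by rewrite !(polyCD, polyCN, polyC1) addrAC.
have ug : uni3 g = (g0%:P + 'X * (g1%:P + 'X * u%:P))%:P.
  rewrite /g !(uni3M, uni3D) !uni3_horner_alg uni3X /vars3 (tnth_nth 0) /=.
  by rewrite -!(polyCD, polyCM).
have uz : uni3 z = 'X by rewrite uni3X /vars3 (tnth_nth 0).
(* [F] is the product of [q] and [g], so that q (1 + z g) = q + z F. *)
clearbody q g z; pose F := (1 - 'X^m)%:P + m%:R *: 'X + v *: 'X^2 + u *: 'X^3.
have uF : uni3 (q * (1 + z * g)) = ((1 - 'X)%:P + 'X)%:P + F *: 'X.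
  rewrite uni3M uni3D uni3M uni31 uz ug uq.
  have -> : F = ((1 - 'X)%:P + 'X) * (g0%:P + 'X * (g1%:P + 'X * u%:P)).
    rewrite /F -E0 -E1 /v -!mul_polyC !(polyCD, polyCM, polyCN).
    ring.
  rewrite -mul_polyC polyCM.
  ring.
exists (q * (1 + z * g)); split; last first.
  exists q, (1 + z * g); split=> //.
    apply: (@uni3_msize _ _ 0 1 0) => //.
    by rewrite uq coefC /= coefD coefX coefC /= add0r coef1 oner_eq0.
  apply: (@uni3_msize _ _ 0 2 1) => //.
  rewrite uni3D uni3M uni31 uz ug coefD coef1 coefXM /= add0r coefC /=.
  rewrite !(coefD, coefC, coefXM) /= !add0r.
  by rewrite uP.
apply/msupp_test_support => j i k; rewrite uF.
rewrite coefD coefZ coefX coefC.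
case: k => [|[|k]] /=; rewrite ?mulr0 ?mulr1 ?addr0 ?add0r.
- rewrite coefD coefC coefX.
  case: i => [|[|i]] /=; rewrite ?addr0 ?add0r.
  + rewrite coefB coef1 coefX.
    by case: j => [|[|j]]; rewrite /= ?subr0 ?sub0r ?oppr_eq0 ?oner_eq0 ?eqxx.
  + by rewrite coef1; case: j => [|j]; rewrite ?oner_eq0 ?eqxx.
  + by rewrite coef0 eqxx.
- rewrite /F !coefD coefC !coefZ coefX !coefXn.
  case: i => [|[|[|[|i]]]] /=; rewrite !(mulr0, mulr1, coef0, addr0, add0r) ?eqxx //.
  + rewrite coefB coef1 coefXn; case: j => [|j] /=.
      by rewrite (ltn_eqF m0) subr0 oner_eq0.
    by case: (j.+1 == m); rewrite ?mulr1n ?sub0r ?subr0 ?oppr_eq0 ?oner_eq0 ?eqxx.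
  + rewrite -polyC_natr coefC.
    by case: j => [|j]; rewrite ?andbT ?andbF ?eqxx.
by rewrite !coef0 eqxx.
Qed.

(** * Translation to the characteristic and conclusion *)

Lemma Z_empty_test_support (K : closedFieldType) m b : (0 < m)%N ->
  Z_empty (test_support m b) K <-> (m%:R != 0 :> K) <> b.
Proof.
move=> m0; split=> [Zm mb|mb p [pm rp]]; last first.
  exact/mb/(test_support_reducible m0 pm rp).
have [p [pm rp]] := test_support_exists K m0.
by apply: (Zm p); split=> //; rewrite -mb.
Qed.

(** A product in a field vanishes only if a factor does; for empty [S] the product is 1 and both
    sides fail. *)
Lemma char_in_prod (K : fieldType) (S : {fset nat}) :
  (forall p, p \in S -> prime p) ->
  char_in K S <-> (\prod_(p <- S) p)%:R = 0 :> K.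
Proof.
move=> hS; rewrite natr_prod; split.
  by move=> [p pS /andP[_ /eqP p0]]; rewrite (big_rem p) //= p0 mul0r.
move/eqP; rewrite prodf_seq_eq0 => /hasP[p pS /= p0].
by exists p => //; rewrite inE hS.
Qed.

Local Open Scope fset_scope.

Theorem theorem4p2 (S : {fset nat}) (hS : forall p : nat, p \in S -> prime p) :
  (exists (n : nat) (I : {fset 'X_{1..n}}),
      [/\ (0 < n)%N, I != fset0 &
          forall K : closedFieldType, Z_empty I K <-> char_in K S])
  /\
  (exists (n : nat) (I : {fset 'X_{1..n}}),
      [/\ (0 < n)%N, I != fset0 &
          forall K : closedFieldType, Z_empty I K <-> ~ char_in K S]).
Proof.
pose m := (\prod_(p <- S) p)%N.
have m0 : (0 < m)%N.
  rewrite /m big_seq; elim/big_ind: _ => // [a b|p /hS /prime_gt0 //].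
  by rewrite muln_gt0 => -> ->.
have I0 b : test_support m b != fset0.
  by apply/fset0Pn; exists (mnm3 0 0 0); rewrite mem_test_support.
split; exists 3%N.
  (* With x z present, emptiness means m = 0 in [K]; without it, m <> 0. *)
  exists (test_support m true); split=> // K.
  rewrite Z_empty_test_support // (char_in_prod K hS) -/m.
  by split=> [/negP|->]; rewrite ?eqxx // negbK => /eqP.
exists (test_support m false); split=> // K.
rewrite Z_empty_test_support // (char_in_prod K hS) -/m.
by case: eqP => [mK|mK]; split=> // H _; apply: H.
Qed.
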